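(* Let $X$ be a non-empty set and $\alpha$ an equivalence relation on $X$ with equivalence classes $\{A_i:i\in I\}$, and let $Q=\operatorname{Reg}(\mathcal T_X(\alpha))$. Then $$\operatorname{rank}(Q)=\begin{cases}|X| & \text{if } \alpha=\nabla,\\ 2^{\|\alpha\|}\prod_{i\in I}|A_i| & \text{if } \|\alpha\| \text{ is infinite},\\ 3 & \text{if } \alpha=\Delta \text{ and } |X|\ge3 \text{ is finite},\\ 1+\prod_{i\in I}|A_i| & \text{otherwise}.\end{cases}$$
   Context: $\mathcal T_X(\alpha)=\{f:X\to X\mid\ker(f)\supseteq\alpha\}$ under composition, $\ker(f)=\{(x,y):xf=yf\}$; $\operatorname{Reg}(T)$ is the set of regular elements (here a subsemigroup). $\|\alpha\|=|I|$ is the number of $\alpha$-classes. $\Delta=\{(x,x):x\in X\}$ and $\nabla=X\times X$. $\operatorname{rank}(T)$ is the minimum cardinality of a generating set of $T$. *)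

(* Defs.v *)
From Stdlib Require Import List RelationClasses.

Set Implicit Arguments.

Section Defs.
Variable X : Type.

Definition TX (alpha : X -> X -> Prop) (f : X -> X) : Prop :=
  forall x y, alpha x y -> f x = f y.

Definition RegT (alpha : X -> X -> Prop) (f : X -> X) : Prop :=
  TX alpha f /\ exists g, TX alpha g /\ forall x, f (g (f x)) = f x.

Inductive generated (G : (X -> X) -> Prop) : (X -> X) -> Prop :=
| gen_base : forall f g, G g -> (forall x, f x = g x) -> generated G f
| gen_comp : forall f g h, generated G g -> generated G h ->
    (forall x, f x = h (g x)) -> generated G f.

Definition generates (alpha : X -> X -> Prop) (G : (X -> X) -> Prop) : Prop :=
  (forall f, G f -> RegT alpha f) /\ (forall f, RegT alpha f -> generated G f).

Definition cls (alpha : X -> X -> Prop) : Type :=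
  { P : X -> Prop | exists x, forall y, P y <-> alpha x y }.

Definition transversal (alpha : X -> X -> Prop) : Type :=
  forall i : cls alpha, { x : X | proj1_sig i x }.

End Defs.

Definition card_le (A B : Type) : Prop :=
  exists h : A -> B, forall a a', h a = h a' -> a = a'.
Definition card_eq (A B : Type) : Prop :=
  exists h : A -> B, (forall a a', h a = h a' -> a = a') /\ (forall b, exists a, h a = b).

Definition rank_is (X : Type) (alpha : X -> X -> Prop) (K : Type) : Prop :=
  (exists G, generates alpha G /\ card_eq { f : X -> X | G f } K) /\
  (forall G, generates alpha G -> card_le K { f : X -> X | G f }).

Definition finite_type (A : Type) : Prop := exists l : list A, forall a, In a l.

(* Main.v *)
From Stdlib Require Import List RelationClasses.
From mathcomp Require Import all_boot all_algebra all_fingroup.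
From mathcomp Require Import boolp classical_sets functions cardinality.
Require Import Defs.

(* A regular element of T_X(alpha) is [reg t phi]: a self-map [phi] of the set I
   of classes, followed by a transversal [t]; and [reg t phi] followed by
   [reg t' phi'] is [reg t' (phi' o phi)]. If [phi] is onto, then [t] is the
   image of [reg t phi] and coincides with the transversal of the last factor of
   any factorization; hence a generating set contains an element [reg t _] with
   onto class map for every [t], and, when there are two classes, an element
   whose class map is not onto.
   For finite I the full transformation monoid of I is generated by a
   transposition, a full cycle and one element that is not onto. If there are at
   least two transversals, the two permutations can be carried by two of the
   compulsory generators, which gives the rank 1 + |T|. If alpha is the identity
   there is one transversal only and the two permutations need two generators,
   unless |I| = 2, where they coincide.
   For infinite I there are 2^|I| permutations of I, so Q has 2^|I| |T| elements;
   this is uncountable, hence equal to the size of any generating set. *)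

Set Implicit Arguments.
Unset Strict Implicit.
Unset Printing Implicit Defensive.

(** * Onto maps and finite types *)

Definition surj (A B : Type) (f : A -> B) := forall b, exists a, f a = b.

Lemma surj_comp (A B C : Type) (f : A -> B) (g : B -> C) :
  surj f -> surj g -> surj (g \o f).
Proof. by move=> fS gS c; have [b <-] := gS c; have [a <-] := fS b; exists a. Qed.

Lemma surj_compl (A B C : Type) (f : A -> B) (g : B -> C) :
  surj (g \o f) -> surj g.
Proof. by move=> gfS c; have [a <-] := gfS c; exists (f a). Qed.

Lemma finite_type_ord (A : Type) : finite_type A ->
  exists n (h : 'I_n -> A) (k : A -> 'I_n), cancel h k /\ cancel k h.
Proof.
elim/Peq : A => A [l lA].
have lA' a : a \in undup l.
  rewrite mem_undup; move: (lA a); elim: l {lA} => //= b l IH; rewrite in_cons.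
  by move=> [->|/IH->]; rewrite ?eqxx ?orbT.
have idx a : index a (undup l) < size (undup l) by rewrite index_mem.
exists (size (undup l)), (tnth (in_tuple (undup l))), (fun a => Ordinal (idx a)).
split=> [i|a]; last by rewrite (tnth_nth a) /= nth_index.
apply: val_inj => /=; rewrite (tnth_nth (tnth (in_tuple (undup l)) i)) /=.
by rewrite index_uniq ?undup_uniq.
Qed.

(** A section [g] of [f] is injective, hence onto once transported to ['I_n]; so every point is some
    [g a], and [f] undoes [g]. *)
Lemma finite_surj_inj (A : Type) (f : A -> A) :
  finite_type A -> surj f -> injective f.
Proof.
move=> /finite_type_ord[n [h [k [hK kK]]]] /choice[g fg].
have g_inj : injective (k \o g \o h).
  by apply: inj_comp (can_inj hK); apply: inj_comp (can_inj kK) (can_inj fg).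
have g_surj a : exists b, g b = a.
  have /mapP[i _ kE] : k a \in codom (k \o g \o h) by exact: injF_onto.
  by exists (h i); apply: (can_inj kK).
by move=> a b; have [a' <-] := g_surj a; have [b' <-] := g_surj b; rewrite !fg => ->.
Qed.

(** * Generators of the full transformation monoid of a finite set *)

(** The generated permutations form a group containing a transposition and the cycle adding 1, which
    generate the symmetric group since the gap between the transposed points, 1, is coprime to the
    length of the cycle. *)
Lemma generated_perm n (p : 'S_n.+2) :
  generated (fun f : 'I_n.+2 -> 'I_n.+2 =>
    f = tperm 0%R 1%R \/ f = perm (GRing.addrI (1 : 'I_n.+2)%R)) p.
Proof.
set G := fun _ => _.
pose H : {set 'S_n.+2} := [set q : 'S_n.+2 | `[< generated G q >]].
have HP (q : 'S_n.+2) : reflect (generated G q) (q \in H) by rewrite inE; exact: asboolP.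
have mulH (q r : 'S_n.+2) : q \in H -> r \in H -> (q * r)%g \in H.
  by move=> /HP Hq /HP Hr; apply/HP; apply: gen_comp Hq Hr _ => x; rewrite permM.
have sH : tperm (0 : 'I_n.+2)%R 1%R \in H by apply/HP; apply: gen_base => //; left.
have cH : perm (GRing.addrI (1 : 'I_n.+2)%R) \in H.
  by apply/HP; apply: gen_base => //; right.
have Hgrp : group_set H.
  (* [generated] has no empty product, so the identity is obtained as the square of the
     transposition. *)
  by apply/group_setP; split=> //; rewrite -(tperm2 (0 : 'I_n.+2)%R 1%R) mulH.
have : p \in [set: 'S_n.+2] by rewrite inE.
rewrite -(@gen_tpermn_circular_shift _ 0%R 1%R) ?GRing.subr0 ?coprimen1 // => pE.
apply/HP; move: p pE; apply/fintype.subsetP; rewrite (gen_subG _ (Group Hgrp)).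
by apply/fintype.subsetP => q; rewrite in_set2 => /orP[/eqP->|/eqP->].
Qed.

Lemma generated_sub (A : Type) (G G' : (A -> A) -> Prop) :
  (forall f, G f -> generated G' f) -> forall f, generated G f -> generated G' f.
Proof.
move=> GG' f; elim=> {f} [f g Gg /funext->|f g h _ IHg _ IHh fE]; first exact: GG'.
exact: gen_comp IHg IHh fE.
Qed.

(* A non-surjective [f] with [f a = f b] and missed value [c] is [f'] followed
   by the collapse [c |-> f a], where [f'] is [f] with [f' a = c] and has a
   larger image. *)
Lemma generated_collapse n (G : ('I_n -> 'I_n) -> Prop) :
  (forall p : 'S_n, generated G p) ->
  (forall c d, c != d -> generated G (fun x => if x == c then d else x)) ->
  forall f, generated G f.
Proof.
move=> Gperm Gcol f.
have [k] := ubnP (n - #|[set f x | x in 'I_n]|).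
elim: k => // k IH in f *; rewrite ltnS => fk.
have [f_inj|] := boolP (injectiveb f).
  apply: gen_comp (Gperm 1%g) (Gperm (perm (injectiveP _ f_inj))) _ => x.
  by rewrite perm1 permE.
move=> /injectivePn[a [b ab fab]].
have /fintype.subsetPn[c _ cf] : ~~ ([set: 'I_n] \subset [set f x | x in 'I_n]).
  apply/negP => /subset_leq_card; rewrite cardsT.
  rewrite leqNgt => /negP; apply; rewrite ltn_neqAle leq_imset_card andbT.
  by apply/negP => /imset_injP f_inj; move: ab; rewrite (f_inj a b) ?eqxx.
pose f' x := if x == a then c else f x.
have cf' x : f x != c by apply: contraNneq cf => <-; apply: imset_f.
have IHf' : generated G f'.
  apply: IH; apply: leq_trans fk.
  have lt : #|[set f x | x in 'I_n]| < #|[set f' x | x in 'I_n]|.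
    apply: proper_card; apply/properP; split.
      apply/fintype.subsetP => _ /imsetP[x _ ->]; have [->|xa] := eqVneq x a.
        by apply/imsetP; exists b => //; rewrite /f' eq_sym (negbTE ab).
      by apply/imsetP; exists x => //; rewrite /f' (negbTE xa).
    exists c => //; apply/imsetP; exists a => //; rewrite /f' eqxx //.
  apply: ltn_sub2l => //; apply: leq_trans lt _.
  by rewrite -[leqRHS]card_ord max_card.
apply: gen_comp IHf' (Gcol c (f a) _) _; first by rewrite eq_sym.
move=> x; rewrite /f'; have [->|_] := eqVneq x a; first by rewrite eqxx.
by rewrite (negbTE (cf' x)).
Qed.

Lemma full_transformation_ord n : exists s t e : 'I_n.+2 -> 'I_n.+2,
  [/\ surj s, surj t, ~ surj e, n = 0 -> s = t &
      forall f, generated (fun k => k = s \/ k = t \/ k = e) f].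
Proof.
pose z : 'I_n.+2 := 0%R; pose u : 'I_n.+2 := 1%R.
pose s := tperm z u; pose t : 'S_n.+2 := perm (GRing.addrI u).
pose e x := if x == z then u else x.
have permS (p : 'S_n.+2) : surj p by move=> y; exists (p^-1%g y); rewrite permKV.
exists s, t, e; split=> //.
- move=> /(_ z)[x]; rewrite /e; case: eqVneq => [_ /esym|]; first exact/eqP.
  by move=> /eqP.
- rewrite /s /t /u /z => n0; move: {permS e s t z u} n0.
  by case: n => // _; apply/funext => -[[|[|//]]] i; rewrite !permE; apply: val_inj.
set G := fun _ => _.
have Gperm (p : 'S_n.+2) : generated G p.
  apply: generated_sub (generated_perm p) => f [->|->]; apply: gen_base => //; first by left.
  by right; left.
have Ge : generated G e by apply: gen_base => //; right; right.
apply: generated_collapse => // c d cd.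
(* A permutation with [z |-> c] and [u |-> d]: it conjugates [e], which collapses [z] to [u], into
   the collapse of [c] to [d]. *)
pose p := (tperm z c * tperm (tperm z c u) d)%g.
have pz : p z = c.
  rewrite permM tpermL tpermD //; last by rewrite eq_sym.
  by rewrite -(inj_eq (@perm_inj _ (tperm z c))) tpermK tpermR eq_sym.
have pu : p u = d by rewrite permM tpermL.
have Gpe : generated G (p \o e) by exact: gen_comp Ge (Gperm p) _.
apply: gen_comp (Gperm p^-1%g) Gpe _ => x.
rewrite /= /e; have [->|xc] := eqVneq x c; first by rewrite -pz permK eqxx pu.
by rewrite -(inj_eq (@perm_inj _ p)) permKV pz (negbTE xc) permKV.
Qed.

Lemma generated_conj (A B : Type) (h : A -> B) (k : B -> A) (G : (A -> A) -> Prop) f :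
  cancel h k -> cancel k h -> generated G (k \o f \o h) ->
  generated (fun g => G (k \o g \o h)) f.
Proof.
move=> hK kK Gf.
have -> : f = h \o (k \o f \o h) \o k by apply/funext => b /=; rewrite !kK.
elim: Gf => {f} [f g Gg /funext->|f g g' _ IHg _ IHg' fE].
  apply: gen_base (fun=> erefl).
  by have -> : k \o (h \o g \o k) \o h = g by apply/funext => a /=; rewrite !hK.
by apply: gen_comp IHg IHg' _ => b /=; rewrite hK fE.
Qed.

(** Transport from ['I_n.+2]. The clause giving [s = t] covers two-point types, where the cycle is
    the transposition; it serves when a single transversal has to carry both. *)
Lemma full_transformation_generators (A : Type) (a b : A) :
  finite_type A -> a <> b ->
  exists s t e : A -> A, [/\ surj s, surj t, ~ surj e,
    (forall c, c = a \/ c = b) -> s = t &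
    forall f, generated (fun k => k = s \/ k = t \/ k = e) f].
Proof.
move=> /finite_type_ord[n [h [k [hK kK]]]] ab.
have kab : k a != k b by apply/eqP => /(can_inj kK).
case: n => [|[|n]] in h k hK kK kab *; first by case: (k a).
  by move: kab; rewrite !ord1.
have [s [t [e [sS tS eS st gen]]]] := full_transformation_ord n.
have conjS f : surj f -> surj (h \o f \o k).
  by move=> fS x; have [i fi] := fS (k x); exists (h i); rewrite /= hK fi kK.
have conjK f : k \o (h \o f \o k) \o h = f by apply/funext => i /=; rewrite !hK.
exists (h \o s \o k), (h \o t \o k), (h \o e \o k); split.
- exact: conjS.
- exact: conjS.
- move=> heS; apply: eS => i; have [x xE] := heS (h i).
  by exists (k x); apply: (can_inj hK).
- move=> cab; congr (h \o _ \o k); apply: st.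
  have : #|[set: 'I_n.+2]| <= #|[set k a; k b]|.
    apply/subset_leq_card/fintype.subsetP => i _; rewrite !inE -(hK i).
    by case: (cab (h i)) => ->; rewrite eqxx ?orbT.
  by rewrite cardsT card_ord cards2 kab; case: (n).
move=> f; apply: generated_sub (generated_conj hK kK (gen _)) => g.
have -> : g = h \o (k \o g \o h) \o k by apply/funext => x /=; rewrite !kK.
by rewrite conjK => gE; apply: gen_base => //; case: gE => [|[]] ->; tauto.
Qed.

Local Open Scope classical_set_scope.

(** * Comparison of cardinals and infinite cardinal arithmetic *)

Lemma card_le_trans (A B C : Type) :
  card_le A B -> card_le B C -> card_le A C.
Proof. by move=> [f f_inj] [g g_inj]; exists (g \o f) => a a' /g_inj/f_inj. Qed.

Lemma card_le_set (A B : Type) :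
  card_le A B -> ([set: A] #<= [set: B])%card.
Proof.
move=> [f f_inj].
have [F] : $|{injfun [set: A] >-> [set: B]}|; last exact: inj_card_le F.
by apply/injfunPex; exists f => // a a' _ _; exact: f_inj.
Qed.

Lemma card_le_antisym (A B : Type) :
  card_le A B -> card_le B A -> card_eq A B.
Proof.
move=> /card_le_set AB /card_le_set BA.
have /card_bijP[f [g fK gK]] := Cantor_Bernstein AB BA.
exists (fun a => set_val (f (SigSub (mem_setT a)))); split=> [a a' /val_inj|b].
  by move=> /(can_inj fK) [].
exists (set_val (g (SigSub (mem_setT b)))).
have -> : SigSub (mem_setT (set_val (g (SigSub (mem_setT b))))) = g (SigSub (mem_setT b)).
  exact: val_inj.
by rewrite gK.
Qed.

Lemma finite_set_finite_type (A : Type) : finite_set [set: A] -> finite_type A.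
Proof.
elim/Peq : A => A /finite_seqP[s sE]; exists s => a.
have : [set: A] a by [].
rewrite sE /=; elim: s {sE} => //= b s IH.
by rewrite in_cons => /orP[/eqP->|/IH]; [left|right].
Qed.

Lemma infinite_card_nat (A : Type) : ~ finite_type A -> card_le nat A.
Proof.
move=> Ainf; have /infiniteP/card_leP[f] : infinite_set [set: A].
  by move=> /finite_set_finite_type.
exists (fun n => set_val (f (SigSub (mem_setT n)))) => m n /val_inj fmn.
have := 'inj_f _ _ fmn.
by rewrite !in_setT => /(_ isT isT)/(congr1 set_val).
Qed.

(** Zorn's lemma on the graphs of partial bijections between [A] and [B]: if a maximal one left out
    both some [x0] in [A] and some [y0] in [B], the pair [(x0, y0)] could be added. *)
Lemma set_comparable (T : Type) (A B : set T) :
  (exists f : T -> T, (forall x, A x -> B (f x)) /\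
     (forall x y, A x -> A y -> f x = f y -> x = y)) \/
  (exists f : T -> T, (forall x, B x -> A (f x)) /\
     (forall x y, B x -> B y -> f x = f y -> x = y)).
Proof.
pose P (R : set (T * T)) := [/\ forall x y, R (x, y) -> A x /\ B y,
  forall x y y', R (x, y) -> R (x, y') -> y = y' &
  forall x x' y, R (x, y) -> R (x', y) -> x = x'].
have [F FP Ftot|M [[MAB Mfun Minj] Mmax]] := @Zorn_bigcup _ P.
  have dir U V : F U -> F V -> exists W, [/\ F W, U `<=` W & V `<=` W].
    by move=> FU FV; have [UV|VU] := Ftot _ _ FU FV; [exists V|exists U]; split.
  split=> [x y [U FU Uxy]|x y y' [U FU Uxy] [V FV Vxy]|x x' y [U FU Uxy] [V FV Vxy]].
  - by have [UAB _ _] := FP _ FU; exact: UAB Uxy.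
  - have [W [FW UW VW]] := dir _ _ FU FV; have [_ Wfun _] := FP _ FW.
    by apply: Wfun (UW _ Uxy) (VW _ Vxy).
  - have [W [FW UW VW]] := dir _ _ FU FV; have [_ _ Winj] := FP _ FW.
    by apply: Winj (UW _ Uxy) (VW _ Vxy).
have [Mtot|] := pselect (forall x, exists y, A x -> M (x, y)).
  left; have [f fM] := choice Mtot; exists f.
  split=> [x Ax|x y Ax Ay fxy]; first by have [] := MAB _ _ (fM _ Ax).
  by apply: Minj (fM _ Ax) _; rewrite fxy; exact: fM.
move=> /existsNP[x0] /forallNP Nx0.
have Ax0 : A x0 by apply: contrapT => N; apply: (Nx0 x0) => /N.
have {}Nx0 y : ~ M (x0, y) by move=> Mx0y; apply: (Nx0 y).
right.
have [Msurj|] := pselect (forall y, exists x, B y -> M (x, y)).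
  have [f fM] := choice Msurj; exists f.
  split=> [y By|x y Bx By fxy]; first by have [] := MAB _ _ (fM _ By).
  by apply: Mfun (fM _ Bx) _; rewrite fxy; exact: fM.
move=> /existsNP[y0] /forallNP Ny0.
have By0 : B y0 by apply: contrapT => N; apply: (Ny0 x0) => /N.
have {}Ny0 x : ~ M (x, y0) by move=> Mxy0; apply: (Ny0 x).
case: (Mmax (M `|` [set (x0, y0)])).
  split; first by move=> p Mp; left.
  by move=> /(_ (x0, y0)) h; apply: (Nx0 y0); apply: h; right.
split=> [x y [/MAB//|[-> ->]]//|x y y' [Mxy|[xE ->]] [Mxy'|[]]|x x' y [Mxy|[-> yE]] [Mxy'|[]]].
- exact: Mfun Mxy Mxy'.
- by move=> xE; move: Mxy; rewrite xE => /Nx0.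
- by move: Mxy'; rewrite xE => /Nx0.
- by [].
- exact: Minj Mxy Mxy'.
- by move=> _ yE; move: Mxy; rewrite yE => /Ny0.
- by move: Mxy'; rewrite yE => /Ny0.
- by [].
Qed.

(* Zorn's lemma on the graphs [R] of injections D * D -> D extending a countable
   one. For a maximal one, if the complement of D embeds in D then so does the
   whole type; if instead j embeds D in the complement, the injection extends
   to D + j(D), sending the three new quadrants into j(D). *)
Lemma infinite_square (I : Type) : card_le nat I -> card_le (I * I) I.
Proof.
move=> [e e_inj].
have [c c_inj] : card_le (nat * nat) nat.
  by exists pickle; exact: (pcan_inj (@pickleK _)).
pose D (R : set (I * I * I)) x := exists v, R ((x, x), v).
pose good (R : set (I * I * I)) :=
  [/\ forall p v v', R (p, v) -> R (p, v') -> v = v',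
      forall p p' v, R (p, v) -> R (p', v) -> p = p',
      forall x y v, R ((x, y), v) -> [/\ D R x, D R y & D R v] &
      forall x y, D R x -> D R y -> exists v, R ((x, y), v)].
pose R0 : set (I * I * I) :=
  [set q | exists m n, q = ((e m, e n), e (c (m, n)))].
have R0D n : D R0 (e n) by exists (e (c (n, n))), n, n.
have R0good : good R0.
  split.
  - by move=> p v v' [m [n [-> ->]]] [m' [n' [/e_inj-> /e_inj-> ->]]].
  - by move=> p p' v [m [n [-> ->]]] [m' [n' [-> /e_inj/c_inj[-> ->]]]].
  - by move=> x y v [m [n [-> -> ->]]].
  - move=> x y [_ [m [_ [-> _ _]]]] [_ [n [_ [-> _ _]]]].
    by exists (e (c (m, n))), m, n.
pose P R := (R = set0 \/ R0 `<=` R) /\ good R.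
have [F FP Ftot|M [M0 Mmax]] := @Zorn_bigcup _ P.
  have dir U V : F U -> F V -> exists W, [/\ F W, U `<=` W & V `<=` W].
    by move=> FU FV; have [UV|VU] := Ftot _ _ FU FV; [exists V|exists U]; split.
  have DS U V x : U `<=` V -> D U x -> D V x by move=> UV [v /UV]; exists v.
  have US U : F U -> U `<=` \bigcup_(X in F) X by move=> FU q Uq; exists U.
  split.
    have [[U [FU UR0]]|NF] := pselect (exists U, F U /\ R0 `<=` U).
      by right=> q /UR0; exact: US.
    left; apply/seteqP; split=> // q [U FU Uq].
    have [[U0|UR0] _] := FP _ FU; first by move: Uq; rewrite U0.
    by case: NF; exists U.
  split.
  - move=> p v v' [U FU Up] [V FV Vp].
    have [W [FW UW VW]] := dir _ _ FU FV; have [_ [Wfun _ _ _]] := FP _ FW.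
    by apply: Wfun (UW _ Up) (VW _ Vp).
  - move=> p p' v [U FU Up] [V FV Vp].
    have [W [FW UW VW]] := dir _ _ FU FV; have [_ [_ Winj _ _]] := FP _ FW.
    by apply: Winj (UW _ Up) (VW _ Vp).
  - move=> x y v [U FU Up]; have [_ [_ _ UD _]] := FP _ FU.
    by have [Ux Uy Uv] := UD _ _ _ Up; split; apply: DS (US _ FU) _.
  - move=> x y [v [U FU Ux]] [w [V FV Vy]].
    have [W [FW UW VW]] := dir _ _ FU FV; have [_ [_ _ _ Wt]] := FP _ FW.
    have [||z Wz] := Wt x y; [by exists v; exact: UW|by exists w; exact: VW|].
    by exists z, W.
have {}M0 : R0 `<=` M /\ good M.
  case: M0 => [[M0|//] _]; case: (Mmax R0); last by split=> //; right.
  rewrite M0; split=> // /(_ ((e 0, e 0), e (c (0, 0)))).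
  by apply; exists 0, 0.
case: M0 => R0M [Mfun Minj MD Mt].
have DMe n : D M (e n) by have [v /R0M] := R0D n; exists v.
have /choice[m mM] (p : I * I) : exists v, D M p.1 -> D M p.2 -> M (p, v).
  case: p => x y /=.
  have [[Dx Dy]|N] := pselect (D M x /\ D M y); last by exists x => Dx Dy; case: N.
  by have [v Mv] := Mt _ _ Dx Dy; exists v.
have mD p : D M p.1 -> D M p.2 -> D M (m p).
  by case: p => x y Dx Dy; have [] := MD _ _ _ (mM (x, y) Dx Dy).
have m_inj x y x' y' : m (x, y) = m (x', y') ->
    D M x -> D M y -> D M x' -> D M y' -> x = x' /\ y = y'.
  move=> xy Dx Dy Dx' Dy'; suff [-> ->] : (x, y) = (x', y') by [].
  by apply: Minj (mM (x, y) Dx Dy) _; rewrite xy; exact: mM.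
have e01 : e 0 <> e 1 by move=> /e_inj.
have [[j [jD j_inj]]|[k [kD k_inj]]] := set_comparable (D M) (~` D M); last first.
  (* The tags [e 0] and [e 1] keep the two halves apart, so [u] injects the whole type into the
     domain, where [m] is a pairing. *)
  pose u x := if pselect (D M x) then m (e 0, x) else m (e 1, k x).
  have uD x : D M (u x).
    by rewrite /u; case: pselect => Dx; apply: mD => //=; exact: kD.
  have u_inj : injective u.
    move=> x y; rewrite /u; case: pselect => Dx; case: pselect => Dy /m_inj.
    - by move=> [].
    - by move=> [//|//|//||/e01//]; exact: kD.
    - by move=> [//||//|//|/esym/e01//]; exact: kD.
    - by move=> [//||//||_ /k_inj]; [exact: kD|exact: kD|apply].
  exists (fun p => m (u p.1, u p.2)) => -[x y] [x' y'] /m_inj /=.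
  by move=> [//|//|//|//|/u_inj-> /u_inj->].
pose E x := D M x \/ exists2 y, D M y & x = j y.
have /choice[o oP] x : exists y, ~ D M x -> E x -> D M y /\ x = j y.
  have [[y Dy xE]|N] := pselect (exists2 y, D M y & x = j y); first by exists y.
  by exists x => NDx [].
pose u x := if pselect (D M x) then m (e 0, x) else m (e 1, o x).
have uD x : E x -> D M (u x).
  rewrite /u => Ex; case: pselect => Dx; apply: mD => //=.
  by have [] := oP _ Dx Ex.
have u_inj x y : E x -> E y -> u x = u y -> x = y.
  move=> Ex Ey; rewrite /u.
  case: pselect => Dx; case: pselect => Dy.
  - by move=> /m_inj[].
  - by have [Doy _] := oP _ Dy Ey; move=> /m_inj[].
  - by have [Dox _] := oP _ Dx Ex; move=> /m_inj[]// /esym.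
  - have [Dox xE] := oP _ Dx Ex; have [Doy yE] := oP _ Dy Ey.
    by move=> /m_inj[]// _ oxy; rewrite xE yE oxy.
pose M' : set (I * I * I) := M `|` [set q | [/\ E q.1.1, E q.1.2,
  ~ (D M q.1.1 /\ D M q.1.2) & q.2 = j (m (u q.1.1, u q.1.2))]].
have DM' x : D M' x <-> E x.
  split=> [[v [Mx|[]//]]|Ex]; first by left; exists v.
  have [[v Mx]|Dx] := pselect (D M x); first by exists v; left.
  by exists (j (m (u x, u x))); right; split=> // -[].
case: (Mmax M').
  split; first by move=> q Mq; left.
  move=> M'M; have /DM'[v /M'M Mv] : E (j (e 0)) by right; exists (e 0).
  by apply: (jD (e 0)) => //; exists v.
split; first by right=> q /R0M; left.
split.
- move=> [x y] v v' [Mv|[/= Ex Ey N ->]] [Mv'|[/= _ _ N' ->]] //.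
  + exact: Mfun Mv Mv'.
  + by case: N'; have [] := MD _ _ _ Mv.
  + by case: N; have [] := MD _ _ _ Mv'.
- move=> [x y] [x' y'] v [Mv|[/= Ex Ey N vE]] [Mv'|[/= Ex' Ey' N' vE']] //.
  + exact: Minj Mv Mv'.
  + have [_ _ Dv] := MD _ _ _ Mv.
    by case: (jD (m (u x', u y'))); [apply: mD; exact: uD|rewrite -vE'].
  + have [_ _ Dv] := MD _ _ _ Mv'.
    by case: (jD (m (u x, u y))); [apply: mD; exact: uD|rewrite -vE].
  + move: vE'; rewrite vE => /j_inj.
    move=> /(_ (mD (_, _) (uD _ Ex) (uD _ Ey)) (mD (_, _) (uD _ Ex') (uD _ Ey'))).
    by move=> /m_inj[]; try exact: uD; move=> /(u_inj _ _ Ex Ex')-> /(u_inj _ _ Ey Ey')->.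
- move=> x y v [/MD[Dx Dy Dv]|[/= Ex Ey _ ->]]; split; apply/DM'=> //; try by left.
  by right; exists (m (u x, u y)) => //; apply: mD; exact: uD.
- move=> x y /DM' Ex /DM' Ey.
  have [[Dx Dy]|N] := pselect (D M x /\ D M y).
    by have [v Mv] := Mt _ _ Dx Dy; exists v; left.
  by exists (j (m (u x, u y))); right.
Qed.

Lemma sig_ext (A : Type) (P : A -> Prop) (u v : {a : A | P a}) :
  sval u = sval v -> u = v.
Proof.
case: u v => [a Pa] [b Pb] /= ab; move: Pb; rewrite -ab => Pb.
by rewrite (Prop_irrelevance Pa Pb).
Qed.

Lemma cantor (A : Type) : ~ card_le (A -> bool) A.
Proof.
move=> [h h_inj]; pose D a := `[< exists2 P : A -> bool, h P = a & ~~ P a >].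
have [DhD|/negP NDhD] := boolP (D (h D)).
  by have /asboolP[P /h_inj->] := DhD; rewrite DhD.
by apply: (NDhD); apply/asboolP; exists D => //; apply/negP.
Qed.

Lemma list_card_le (A : Type) : card_le nat A -> card_le (list A) A.
Proof.
move=> Ainf; have [p p_inj] := infinite_square Ainf; have [e e_inj] := Ainf.
(* [code] alone need not separate lists of different lengths, so the length is stored with it. *)
pose code := foldr (fun a b => p (a, b)) (e 0).
exists (fun l => p (e (size l), code l)) => l l' /p_inj[/e_inj].
elim: l l' => [|a l IH] [|a' l'] //= [sz] /p_inj[-> cd].
by rewrite (IH l').
Qed.

Lemma finite_list_card_le (A : Type) : finite_type A -> card_le (list A) nat.
Proof.
move=> /finite_type_ord[n [h [k [_ kK]]]].
exists (fun l => pickle [seq k a | a <- l]) => l l'.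
by move=> /(pcan_inj (@pickleK _))/(inj_map (can_inj kK)).
Qed.

Lemma card_eq_image (A B : Type) (g : B -> A) :
  injective g -> card_eq {a : A | exists b, a = g b} B.
Proof.
move=> g_inj.
have /choice[h hE] (s : {a : A | exists b, a = g b}) : exists b, sval s = g b.
  by case: s.
exists h; split=> [s s' ss'|b]; first by apply: sig_ext; rewrite !hE ss'.
by exists (exist _ (g b) (ex_intro _ b erefl)); apply: g_inj; rewrite -hE.
Qed.

(** * Transformations of a set: regularity, words and onto maps *)

Lemma quasi_inverse (A : Type) (f : A -> A) : exists g, forall x, f (g (f x)) = f x.
Proof.
have /choice[g gE] y : exists x, forall z, f z = y -> f x = y.
  by have [[x xE]|N] := pselect (exists x, f x = y);
    [exists x|exists y => z zE; case: N; exists z].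
by exists g => x; exact: gE.
Qed.

(** Meant for counting: there are no more generated maps than lists of generators. *)
Lemma generated_word (A : Type) (G : (A -> A) -> Prop) f : generated G f ->
  exists l : list {g | G g}, f = foldr (fun s k => sval s \o k) id l.
Proof.
elim=> {f} [f g Gg /funext->|f g h _ [lg gE] _ [lh hE] /funext->].
  by exists [:: exist _ g Gg].
exists (lh ++ lg); rewrite foldr_cat -gE hE.
by elim: lh {hE} => //= s l IH; apply/funext => x /=; rewrite -IH.
Qed.

Lemma generated_surj (A : Type) (G : (A -> A) -> Prop) :
  (forall f, G f -> surj f) -> forall f, generated G f -> surj f.
Proof.
move=> GS f; elim=> {f} [f g Gg /funext->|f g h _ gS _ hS /funext->]; first exact: GS.
exact: surj_comp gS hS.
Qed.

Lemma exists_nonsurj (A : Type) (a b : A) : a <> b -> ~ surj (fun _ : A => a).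
Proof. by move=> ab /(_ b)[]. Qed.

(* If at most one generator [s] were a unit, every unit would lie in the double
   centralizer of [s], so all units would commute. *)
Lemma full_transformation_three (A : Type) (a b c : A) (G : (A -> A) -> Prop) :
  finite_type A -> a <> b -> b <> c -> a <> c -> (forall f, generated G f) ->
  exists s t e, [/\ G s, G t & G e] /\ [/\ surj s, surj t, ~ surj e & s <> t].
Proof.
move=> Afin ab bc ac Ggen.
have [e [Ge eS]] : exists e, G e /\ ~ surj e.
  apply: contrapT => N; apply: (exists_nonsurj ab); apply: generated_surj (Ggen _).
  by move=> f Gf; apply: contrapT => fS; apply: N; exists f.
(* By finiteness the onto map [h] is injective, and cancelling it shows that [g] is onto. *)
have unit_comp (g h : A -> A) : surj (h \o g) -> surj g /\ surj h.
  move=> hgS; have hS := surj_compl hgS; split=> // x.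
  by have [y hy] := hgS (h x); exists y; exact: (finite_surj_inj Afin hS).
have [s [Gs sS]] : exists s, G s /\ surj s.
  suff H f : generated G f -> surj f -> exists s, G s /\ surj s.
    by apply: H (Ggen id) _ => x; exists x.
  elim=> {f} [f g Gg /funext-> gS|f g h _ _ _ IHh /funext-> /surj_compl]; last exact: IHh.
  by exists g.
have [[t [Gt tS ts]]|N] := pselect (exists t, [/\ G t, surj t & t <> s]).
  by exists s, t, e; do 2!split=> //; exact/nesym.
have comm f : surj f -> forall k, s \o k = k \o s -> f \o k = k \o f.
  elim: (Ggen f) => {f} [f g Gg /funext-> gS k sk|f g h _ IHg _ IHh /funext->].
    suff -> : g = s by [].
    by apply: contrapT => gs; apply: N; exists g.
  move=> /unit_comp[gS hS] k sk; apply/funext => x /=.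
  have /(congr1 (fun u => u x)) /= -> := IHg gS _ sk.
  by have /(congr1 (fun u => u (g x))) := IHh hS _ sk.
pose swap (x y z : A) := if pselect (z = x) then y else if pselect (z = y) then x else z.
have swapS x y : surj (swap x y).
  move=> z; exists (swap x y z); rewrite /swap.
  by repeat case: pselect => ? //=; congruence.
(* Two uses of [comm]: [swap b c] commutes with [s], hence [swap a b] commutes with [swap b c]. But
   at [a] the two products take the values [b] and [c]. *)
have := comm _ (swapS a b) (swap b c) (esym (comm _ (swapS b c) _ erefl)).
move=> /(congr1 (fun u => u a)) /=; rewrite /swap.
by repeat case: pselect => ? //=; congruence.
Qed.

(* With [j : A -> bool -> A] injective, [S] is sent to the permutation of [A]
   exchanging [j i true] and [j i false] for each [i] in [S]. *)
Lemma powerset_surj (A : Type) : card_le nat A ->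
  exists phi : (A -> bool) -> A -> A, injective phi /\ forall S, surj (phi S).
Proof.
move=> Ainf; have [p p_inj] := infinite_square Ainf; have [e e_inj] := Ainf.
pose j (i : A) (b : bool) := p (i, e b).
have j_inj i b i' b' : j i b = j i' b' -> i = i' /\ b = b'.
  by move=> /p_inj[-> /e_inj]; case: b b' => [] [].
have /choice[phi phiE] S : exists f : A -> A, (forall i b, f (j i b) = j i (b (+) S i)) /\
    (forall k, (forall i b, k <> j i b) -> f k = k).
  have /choice[f fE] k : exists y, (forall i b, k = j i b -> y = j i (b (+) S i)) /\
      ((forall i b, k <> j i b) -> y = k).
    have [[i [b kE]]|N] := pselect (exists i b, k = j i b).
      exists (j i (b (+) S i)); split=> [i' b'|/(_ i b)//].
      by rewrite kE => /j_inj[-> ->].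
    by exists k; split=> // i b kE; case: N; exists i, b.
  exists f; split=> [i b|k kN]; first by have [fk _] := fE (j i b); exact: fk.
  by have [_] := fE k; exact.
exists phi; split=> [S S' SS'|S k].
  apply/funext => i; have [SE _] := phiE S; have [S'E _] := phiE S'.
  by have := SE i false; rewrite SS' S'E /= => /j_inj[].
have [SE SN] := phiE S.
have [[i [b ->]]|N] := pselect (exists i b, k = j i b).
  by exists (j i (b (+) S i)); rewrite SE -addbA addbb addbF.
by exists k; apply: SN => i b kE; apply: N; exists i, b.
Qed.

(** * Regular elements as pairs of a transversal and a class map *)

Section Regular.
Variables (X : Type) (alpha : X -> X -> Prop).
Hypothesis halpha : Equivalence alpha.
Local Notation I := (cls alpha).
Local Notation T := (transversal alpha).

Definition quot (x : X) : I :=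
  exist (fun P => exists x, forall y, P y <-> alpha x y) (alpha x)
    (ex_intro _ x (fun y => iff_refl (alpha x y))).

Definition elt (t : T) (i : I) : X := sval (t i).

Definition reg (t : T) (phi : I -> I) : X -> X := elt t \o phi \o quot.

Lemma mem_quot (i : I) x : sval i x -> quot x = i.
Proof.
have [_ sym trans] := halpha.
case: i => P [z Pz] /= Px; apply: sig_ext => /=; apply/funext => y; apply/propext.
have zx : alpha z x by apply/Pz.
split=> [xy|/Pz zy]; first by apply/Pz; exact: trans zx xy.
exact: trans (sym _ _ zx) zy.
Qed.

Lemma quotP x y : quot x = quot y <-> alpha x y.
Proof.
have [rfl sym _] := halpha.
split=> [/(congr1 sval)/= ->|xy]; first exact: rfl.
by apply: mem_quot; exact: sym.
Qed.

Lemma elt_quot t : cancel (elt t) quot.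
Proof. by move=> i; apply: mem_quot; exact: (svalP (t i)). Qed.

Lemma surj_quot : surj quot.
Proof.
have [rfl _ _] := halpha.
by move=> [P [x Px]]; exists x; apply: mem_quot; apply/Px; exact: rfl.
Qed.

Lemma elt_inj : injective elt.
Proof.
move=> t t' tt'; apply: functional_extensionality_dep => i.
by apply: sig_ext; have := congr1 (fun u => u i) tt'.
Qed.

(** Outside [D] any representative is taken; an empty [D] gives the mere existence of a
    transversal. *)
Lemma exists_transversal (f : I -> X) (D : set I) : (forall i, D i -> quot (f i) = i) ->
  exists t, forall i, D i -> elt t i = f i.
Proof.
have [rfl _ _] := halpha; move=> fD.
have t_ex i : {x : X | sval i x /\ (D i -> x = f i)}.
  apply: cid; have [Di|NDi] := pselect (D i).
    by exists (f i); rewrite -{1}(fD i Di) /=; split=> //; exact: rfl.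
  by case: i NDi => P [x Px] NDi; exists x; split=> //; apply/Px; exact: rfl.
exists (fun i => exist _ (sval (t_ex i)) (svalP (t_ex i)).1) => i.
exact: (svalP (t_ex i)).2.
Qed.

Lemma reg_comp t phi t' phi' : reg t' phi' \o reg t phi = reg t' (phi' \o phi).
Proof. by apply/funext => x; rewrite /reg /= elt_quot. Qed.

Lemma reg_fun_inj t phi t' phi' : reg t phi = reg t' phi' -> phi = phi'.
Proof.
move=> tt'; apply/funext => i; have [x <-] := surj_quot i.
have /(congr1 quot) := congr1 (fun f => f x) tt'.
by rewrite /reg /= !elt_quot.
Qed.

(** [reg t phi] shows [t] only on the range of [phi], whence the condition that [phi] be onto. *)
Lemma reg_elt_inj t phi t' phi' : surj phi -> reg t phi = reg t' phi' -> t = t'.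
Proof.
move=> phiS tt'; apply: elt_inj; apply/funext => i.
have [k <-] := phiS i; have [x <-] := surj_quot k.
by have := congr1 (fun f => f x) tt'; rewrite /reg /= -(reg_fun_inj tt').
Qed.

Lemma RegTP f : RegT alpha f <-> exists t phi, f = reg t phi.
Proof.
split=> [[fT [g [gT fgf]]]|[t [phi ->]]]; last first.
  have [psi phiK] := quasi_inverse phi; split.
    by move=> x y /quotP xy; rewrite /reg /= xy.
  exists (reg t psi); split; first by move=> x y /quotP xy; rewrite /reg /= xy.
  by move=> x; rewrite /reg /= !elt_quot phiK.
have [r rK] := choice surj_quot.
have fr x : f (r (quot x)) = f x by apply: fT; apply/quotP; rewrite rK.
(* A class meets the image of [f] in at most one point: [g] is constant on classes and
   [f (g (f x)) = f x]. On the classes that meet the image, the transversal must pick that point. *)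
have [|t tE] := @exists_transversal (f \o g \o r) (range (quot \o f)).
  move=> _ [x _ <-] /=; congr quot; rewrite -[RHS]fgf; congr f.
  by apply: gT; apply/quotP; rewrite rK.
exists t, (quot \o f \o r); apply/funext => x; rewrite /reg /= fr tE /=; last by exists x.
by rewrite -[LHS]fgf; congr f; apply: gT; apply/quotP; rewrite rK.
Qed.

(** * Sizes of generating sets of the regular elements *)

Lemma generates_RegT : generates alpha (RegT alpha).
Proof. by split=> // f fR; exact: gen_base fR (fun=> erefl). Qed.

(* The last factor of a product with surjective class map already has the same
   transversal, so every transversal must be hit by a generator. *)
Lemma generates_last G t (phi : I -> I) : generates alpha G -> surj phi ->
  exists g phi', [/\ G g, g = reg t phi' & surj phi'].
Proof.
move=> [GR Ggen] phiS.
have /Ggen : RegT alpha (reg t phi) by apply/RegTP; exists t, phi.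
move: {-2}(reg t phi) (erefl (reg t phi)) => f fE fG.
have GR' k : generated G k -> exists t phi, k = reg t phi.
  elim=> {k} [k g Gg /funext->|k g h _ [tg [pg ->]] _ [th [ph ->]] /funext->].
    by apply/RegTP; exact: GR.
  by exists th, (ph \o pg); rewrite -(reg_comp tg).
elim: fG phi phiS fE => {f} [f g Gg /funext-> phi phiS gE|]; first by exists g, phi.
move=> f g h gG _ hG IHh /funext-> phi phiS hgE.
have [tg [pg gE]] := GR' _ gG; have [th [ph hE]] := GR' _ hG.
have hgE' : reg t phi = reg th (ph \o pg) by rewrite -(reg_comp tg) -hE -gE -hgE.
apply: (IHh ph); last by rewrite hE (reg_elt_inj phiS hgE').
by apply: (@surj_compl _ _ _ pg); rewrite -(reg_fun_inj hgE').
Qed.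

Lemma option_transversal_card_le G : (exists i j : I, i <> j) -> generates alpha G ->
  card_le (option T) {f | G f}.
Proof.
move=> [i [j ij]] Ggen; have [GR Gall] := Ggen.
have /choice[g gE] t : exists s : {f | G f}, exists2 phi, sval s = reg t phi & surj phi.
  have [|g [phi [Gg gE phiS]]] := @generates_last G t id Ggen; first by move=> x; exists x.
  by exists (exist _ g Gg), phi.
(* This [k] is the image of [None]. Without it all products would have onto class maps, yet the
   class map constant at [i] is not onto. *)
have [k [Gk kS]] : exists k, G k /\ forall t phi, surj phi -> k <> reg t phi.
  apply: contrapT => N.
  have H f : generated G f -> exists t phi, surj phi /\ f = reg t phi.
    elim=> {f} [f k Gk /funext->|f k h _ [tk [pk [pkS ->]]] _ [th [ph [phS ->]]] /funext->].
      apply: contrapT => kN; apply: N; exists k; split=> // t phi phiS kE.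
      by apply: kN; exists t, phi.
    by exists th, (ph \o pk); split; [exact: surj_comp|rewrite -(reg_comp tk)].
  have [//|t _] := @exists_transversal (fun=> sval (cid (surj_quot i))) set0.
  have /Gall/H[t' [phi [phiS tE]]] : RegT alpha (reg t (fun=> i)).
    by apply/RegTP; exists t, (fun=> i).
  by apply: (exists_nonsurj ij); rewrite (reg_fun_inj tE).
exists (fun o => if o is Some t then g t else exist _ k Gk) => -[t|] [t'|] //=.
- have [phi tE phiS] := gE t; have [phi' t'E phiS'] := gE t'.
  by move=> /(congr1 sval); rewrite tE t'E => /(reg_elt_inj phiS)->.
- by move=> /(congr1 sval) /=; have [phi -> phiS] := gE t => /esym/kS.
- by move=> /(congr1 sval) /=; have [phi -> phiS] := gE t' => /kS.
Qed.

(** Every class map arises with some uncontrolled transversal. To reach [reg t phi], lift [phi]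
    through the onto map [psi t] to [r], generate some [reg t' r], and end with the generator
    [reg t (psi t)], which replaces [t'] by [t]. *)
Lemma option_transversal_generates (psi : T -> I -> I) (e : I -> I) :
  (forall t, surj (psi t)) -> ~ surj e ->
  (forall phi, generated (fun k => k = e \/ exists t, k = psi t) phi) ->
  inhabited T ->
  exists G, generates alpha G /\ card_eq {f | G f} (option T).
Proof.
move=> psiS eS gen [t0].
pose g o := if o is Some t then reg t (psi t) else reg t0 e.
have g_inj : injective g.
  move=> [t|] [t'|] //= => [/(reg_elt_inj (psiS t))-> //|/reg_fun_inj psie|/reg_fun_inj psie].
    by case: eS; rewrite -psie.
  by case: eS; rewrite psie.
exists (fun f => exists o, f = g o); split; last exact: card_eq_image.
split=> [_ [[t|] ->]|f /RegTP[t [phi ->]]]; try by apply/RegTP; eexists; eexists.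
have gen' phi' : exists t', generated (fun f => exists o, f = g o) (reg t' phi').
  elim: (gen phi') => {f phi'} [_ k [->|[t' ->]] /funext->|].
  - by exists t0; apply: gen_base (fun=> erefl); exists None.
  - by exists t'; apply: gen_base (fun=> erefl); exists (Some t').
  move=> _ k h _ [tk tkG] _ [th thG] /funext->.
  by exists th; apply: gen_comp tkG thG _ => x; rewrite -(reg_comp tk).
have /choice[r rE] i : exists j, psi t j = phi i by exact: psiS.
have [t' t'G] := gen' r.
have tG : generated (fun f => exists o, f = g o) (reg t (psi t)).
  by apply: gen_base (fun=> erefl); exists (Some t).
apply: gen_comp t'G tG _ => x.
by rewrite /reg /= elt_quot rE.
Qed.

(** The elements with class map from [powerset_surj] inject into the words over [G]. For infinite
    [G] there are no more words than generators; for finite [G] there are countably many, against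
    Cantor's theorem. *)
Lemma generates_infinite_card_le G : card_le nat I -> inhabited T -> generates alpha G ->
  card_le ((I -> bool) * T) {f | G f}.
Proof.
move=> Iinf [t0] [_ Gall].
have [phi [phi_inj phiS]] := powerset_surj Iinf.
have Klist : card_le ((I -> bool) * T) (list {f | G f}).
  have /choice[w wE] (q : (I -> bool) * T) : exists l : list {f | G f},
      reg q.2 (phi q.1) = foldr (fun s k => sval s \o k) id l.
    by apply/generated_word/Gall/RegTP; exists q.2, (phi q.1).
  exists w => -[S t] [S' t'] ww.
  have /= tt' : reg (S, t).2 (phi (S, t).1) = reg (S', t').2 (phi (S', t').1).
    by rewrite !wE ww.
  by rewrite (reg_elt_inj (phiS S) tt') (phi_inj _ _ (reg_fun_inj tt')).
have [Gfin|Ginf] := pselect (finite_type {f | G f}); last first.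
  exact: card_le_trans Klist (list_card_le (infinite_card_nat Ginf)).
case: (@cantor I).
apply: card_le_trans (card_le_trans Klist (card_le_trans (finite_list_card_le Gfin) Iinf)).
by exists (fun S => (S, t0)) => S S' [].
Qed.

Lemma RegT_infinite_card_le : card_le nat I ->
  card_le {f | RegT alpha f} ((I -> bool) * T).
Proof.
move=> Iinf; have [p p_inj] := infinite_square Iinf.
have /choice[q qE] (s : {f | RegT alpha f}) :
    exists q : T * (I -> I), sval s = reg q.1 q.2.
  by case: s => f /= /RegTP[t [phi ->]]; exists (t, phi).
(* The class map is recorded by its graph, a subset of [I * I] coded in [I] by [p]. *)
exists (fun s => (fun k => `[< exists i, k = p (i, (q s).2 i) >], (q s).1)) => s s' [pq tq].
apply: sig_ext; rewrite !qE tq; congr reg; apply/funext => i.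
have : `[< exists i', p (i, (q s).2 i) = p (i', (q s).2 i') >] by apply/asboolP; exists i.
have /= -> := congr1 (fun u => u (p (i, (q s).2 i))) pq.
by move=> /asboolP[i' /p_inj[-> ->]].
Qed.

(** * The four cases of the rank formula *)

(** All elements are constant maps, so a product equals its last factor and a generating set must
    contain every constant. *)
Lemma rank_nabla : inhabited X -> (forall x y, alpha x y) -> rank_is alpha X.
Proof.
move=> [x0] nabla.
have RegT_cst c : RegT alpha (fun=> c) by split=> //; exists (fun=> c).
have RegT_const f : RegT alpha f -> f = fun=> f x0.
  by move=> [fT _]; apply/funext => x; exact: fT.
split.
  exists (RegT alpha); split; first exact: generates_RegT.
  exists (fun s => sval s x0); split=> [s s' ss'|c]; last by exists (exist _ _ (RegT_cst c)).
  by apply: sig_ext; rewrite (RegT_const _ (svalP s)) (RegT_const _ (svalP s')) ss'.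
move=> G [GR Gall].
have GRegT f : generated G f -> G f.
  elim=> {f} [f g Gg /funext-> //|f g h _ _ _ Gh /funext->].
  suff -> : (fun x => h (g x)) = h by [].
  by rewrite (RegT_const _ (GR _ Gh)).
exists (fun c => exist _ _ (GRegT _ (Gall _ (RegT_cst c)))) => c c'.
by move=> /(congr1 (fun s => sval s x0)).
Qed.

Lemma rank_discrete : (forall x y, alpha x y -> x = y) -> finite_type X ->
  (exists a b c : X, a <> b /\ b <> c /\ a <> c) ->
  rank_is alpha {n : nat | (n < 3)%coq_nat}.
Proof.
move=> discr Xfin [a [b [c [ab [bc ac]]]]].
have RegT_all f : RegT alpha f.
  split=> [x y /discr-> //|]; have [g gE] := quasi_inverse f.
  by exists g; split=> // x y /discr->.
pose pick3 (s t e : X -> X) n := match n with 0 => s | 1 => t | _ => e end.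
have pick3_inj s t e : s <> t -> surj s -> surj t -> ~ surj e ->
    injective (fun n : {n : nat | (n < 3)%coq_nat} => pick3 s t e (sval n)).
  move=> st sS tS eS [m m3] [n n3] /= mn; apply: sig_ext => /=.
  move/ltP: m3 => m3; move/ltP: n3 => n3.
  case: m m3 mn => [|[|[|//]]] _; case: n n3 => [|[|[|//]]] _ //= E; exfalso;
    by [apply: st|apply: st; rewrite E|apply: eS; rewrite -E|apply: eS; rewrite E].
split; last first.
  move=> G [_ Gall].
  have [s [t [e [[Gs Gt Ge] [sS tS eS st]]]]] :=
    full_transformation_three Xfin ab bc ac (fun f => Gall f (RegT_all f)).
  have GP n : G (pick3 s t e n) by case: n => [|[|n]].
  exists (fun n => exist _ _ (GP (sval n))) => m n /(congr1 sval) /=.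
  exact: pick3_inj.
have [s [t [e [sS tS eS _ gen]]]] := full_transformation_generators Xfin ab.
(* Otherwise [s] would be the only onto generator, against [full_transformation_three] applied to
   this very generating set. *)
have st : s <> t.
  move=> st; have [s' [t' [e' [[+ + _] [sS' tS' eS']]]]] :=
    full_transformation_three Xfin ab bc ac gen.
  rewrite -st => -[->|[->|s'e]] [->|[->|t'e]] //; try by move: eS; rewrite -?s'e -?t'e.
eexists; split; last exact: card_eq_image (pick3_inj _ _ _ st sS tS eS).
split=> // f _; apply: generated_sub (gen f) => {}f fE; apply: gen_base (fun=> erefl).
have H3 n : (n < 3)%N -> (n < 3)%coq_nat by move/ltP.
by case: fE => [|[|]] ->; [exists (exist _ 0 (H3 0 isT))|exists (exist _ 1 (H3 1 isT))|
  exists (exist _ 2 (H3 2 isT))].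
Qed.

Lemma exists_quot_neq : ~ (forall x y, alpha x y) -> exists i j : I, i <> j.
Proof.
move=> /existsNP[x /existsNP[y xy]]; exists (quot x), (quot y).
by move=> /quotP.
Qed.

Lemma inhabited_transversal : inhabited T.
Proof.
have [//|t _] := @exists_transversal (fun i => sval (cid (surj_quot i))) set0.
by constructor.
Qed.

Lemma rank_infinite : ~ finite_type I -> rank_is alpha ((I -> bool) * T)%type.
Proof.
move=> /infinite_card_nat Iinf; have T0 := inhabited_transversal.
split; last by move=> G; exact: generates_infinite_card_le.
exists (RegT alpha); split; first exact: generates_RegT.
apply: card_le_antisym; first exact: RegT_infinite_card_le.
exact: generates_infinite_card_le generates_RegT.
Qed.

Lemma rank_finite : ~ (forall x y, alpha x y) -> finite_type I ->
  ~ ((forall x y, alpha x y -> x = y) /\ finite_type X /\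
     (exists a b c : X, a <> b /\ b <> c /\ a <> c)) ->
  rank_is alpha (option T).
Proof.
move=> /exists_quot_neq ij Ifin Ndiscr; split; last first.
  by move=> G; exact: option_transversal_card_le.
have [t0] := inhabited_transversal.
have [i [j ij']] := ij.
have [s [t [e [sS tS eS st gen]]]] := full_transformation_generators Ifin ij'.
(* [t0] carries [s] and every other transversal carries [t], so both occur as soon as there are two
   transversals. *)
pose psi t' := if pselect (t' = t0) then s else t.
apply: (@option_transversal_generates psi e) => // [t'|phi].
  by rewrite /psi; case: pselect.
apply: generated_sub (gen phi) => k kE; apply: gen_base (fun=> erefl).
case: kE => [->|[->|->]]; [by right; exists t0; rewrite /psi; case: pselect| |by left].
right; have [[t1 t10]|N] := pselect (exists t1, t1 <> t0).
  by exists t1; rewrite /psi; case: pselect.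
(* With [t0] the only transversal, [s = t] is needed. Every class is a singleton, since another
   representative would give a second transversal; a third class would then yield three points of a
   finite [X], which [Ndiscr] excludes. *)
exists t0; rewrite /psi; case: pselect => //= t00; apply/esym/st.
have discr x y : alpha x y -> x = y.
  have eltE z : elt t0 (quot z) = z.
    have [l ->|t1 tE] := @exists_transversal (fun=> z) [set quot z]; first by [].
    have -> : t0 = t1 by apply: contrapT => t01; apply: N; exists t1; exact/nesym.
    exact: tE.
  by move=> /quotP xy; rewrite -(eltE x) xy eltE.
move=> c; apply: contrapT => /not_orP[ci cj]; apply: Ndiscr; split=> //; split.
  have [l lI] := Ifin; exists (List.map (elt t0) l) => x.
  by apply/in_map_iff; exists (quot x); split=> //; apply/discr/quotP; rewrite elt_quot.
have elt0_inj := can_inj (elt_quot t0).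
by exists (elt t0 i), (elt t0 j), (elt t0 c); do 2?split; move=> /elt0_inj// /esym.
Qed.

End Regular.

Theorem theorem5p26 (X : Type) (alpha : X -> X -> Prop)
  (hX : inhabited X) (halpha : Equivalence alpha) :
  (* alpha = nabla *)
  ((forall x y, alpha x y) -> rank_is alpha X) /\
  (* ||alpha|| infinite *)
  (~ finite_type (cls alpha) ->
     rank_is alpha ((cls alpha -> bool) * transversal alpha)%type) /\
  (* alpha = Delta and |X| >= 3 finite *)
  ((forall x y, alpha x y -> x = y) -> finite_type X ->
     (exists a b c : X, a <> b /\ b <> c /\ a <> c) ->
     rank_is alpha { n : nat | (n < 3)%coq_nat }) /\
  (* otherwise *)
  (~ (forall x y, alpha x y) -> finite_type (cls alpha) ->
     ~ ((forall x y, alpha x y -> x = y) /\ finite_type X /\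
        (exists a b c : X, a <> b /\ b <> c /\ a <> c)) ->
     rank_is alpha (option (transversal alpha))).
Proof.
split; first exact: rank_nabla.
split; first exact: rank_infinite.
by split; [exact: rank_discrete|exact: rank_finite].
Qed.
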